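(* Let $A$ be an integer matrix with $n$ columns, and let $R_1,\dots,R_{n+1}$ be $n+1$ subsets of the set of rows of $A$ such that every row of $A$ belongs to at least $n$ of these subsets. If for each $i$ the tropical linear system formed by the rows in $R_i$ is feasible, then the tropical linear system $A$ is feasible. Moreover, given solutions of each of these $n+1$ systems, a solution of $A$ can be computed in polynomial time.
   Context: A tropical linear system is given by an $m\times n$ matrix $A=(a_{ij})$. A solution is a row $x=(x_1,\dots,x_n)$ such that for every row $i$ the minimum $\min_j(a_{ij}+x_j)$ is attained at least twice. The system is feasible if a solution exists. Arithmetic operations on matrix entries are assumed to take $O(1)$ time. *)

(* Defs.v *)
From HB Require Import structures.
From mathcomp Require Import all_boot all_order all_algebra.
Set Implicit Arguments.
Unset Strict Implicit.
Unset Printing Implicit Defensive.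
Import Order.TTheory GRing.Theory Num.Theory.
Local Open Scope ring_scope.

(* The matrix of a system is integer; solutions have their entries in an
   arbitrary ordered domain [R], which covers both R = int and the reals. *)

Definition minimizers (R : realDomainType) (n : nat) (a : 'rV[int]_n)
    (x : 'rV[R]_n) : {set 'I_n} :=
  [set j | [forall k, (a 0 j)%:~R + x 0 j <= (a 0 k)%:~R + x 0 k]].

Definition tropical_solution (R : realDomainType) (m n : nat)
    (A : 'M[int]_(m, n)) (x : 'rV[R]_n) : Prop :=
  forall i : 'I_m, (1 < #|minimizers (row i A) x|)%N.

Definition tropical_feasible (R : realDomainType) (m n : nat)
    (A : 'M[int]_(m, n)) : Prop :=
  exists x : 'rV[R]_n, tropical_solution A x.

Definition subsystem (m n : nat) (A : 'M[int]_(m, n)) (S : {set 'I_m}) :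
    'M[int]_(#|S|, n) :=
  rowsub (fun k : 'I_#|S| => enum_val k) A.

(* Running time is measured on while-programs for a unit-cost random access
   machine. Its memory holds naturals, used for control and addressing, and
   numbers, taken in [R]; both are stored in arrays with two subscripts, a
   scalar variable being a cell of such an array.  The arithmetic is
   addition, subtraction and comparison only: with multiplication at unit
   cost, numbers of exponential bit length could be built in polynomial time.
   Programs mention neither [R] nor the dimensions of their input. *)

Inductive iexp : Type :=
| ICst of nat
| IGet of nat & iexp & iexp
| IAdd of iexp & iexp
| ISub of iexp & iexp.

Inductive vexp : Type :=
| VGet of nat & iexp & iexp
| VAdd of vexp & vexp
| VSub of vexp & vexp.

Inductive bexp : Type :=
| BLeI of iexp & iexp
| BLeV of vexp & vexp
| BNot of bexp
| BAnd of bexp & bexp.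

Inductive cmd : Type :=
| CSkip
| CSetI of nat & iexp & iexp & iexp
| CSetV of nat & iexp & iexp & vexp
| CSeq of cmd & cmd
| CIf of bexp & cmd & cmd
| CWhile of bexp & cmd.

Record memory (R : realDomainType) : Type := Memory {
  idx : nat -> nat -> nat -> nat;
  num : nat -> nat -> nat -> R }.

Definition update (T : Type) (f : nat -> nat -> nat -> T) (a i j : nat) (v : T)
    : nat -> nat -> nat -> T :=
  fun a' i' j' => if [&& a' == a, i' == i & j' == j] then v else f a' i' j'.

Fixpoint ieval (R : realDomainType) (s : memory R) (e : iexp) : nat :=
  match e with
  | ICst k => k
  | IGet a i j => idx s a (ieval s i) (ieval s j)
  | IAdd e1 e2 => (ieval s e1 + ieval s e2)%N
  | ISub e1 e2 => (ieval s e1 - ieval s e2)%N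
  end.

Fixpoint veval (R : realDomainType) (s : memory R) (e : vexp) : R :=
  match e with
  | VGet a i j => num s a (ieval s i) (ieval s j)
  | VAdd e1 e2 => veval s e1 + veval s e2
  | VSub e1 e2 => veval s e1 - veval s e2
  end.

Fixpoint beval (R : realDomainType) (s : memory R) (b : bexp) : bool :=
  match b with
  | BLeI e1 e2 => (ieval s e1 <= ieval s e2)%N
  | BLeV e1 e2 => veval s e1 <= veval s e2
  | BNot b1 => ~~ beval s b1
  | BAnd b1 b2 => beval s b1 && beval s b2
  end.

(* [exec c s t s'] : run from [s], the program [c] halts in [s'] after [t]
   steps. An assignment or the evaluation of a test is one step: the size of
   the expression involved is bounded by a constant of the program. *)
Inductive exec (R : realDomainType) :
    cmd -> memory R -> nat -> memory R -> Prop :=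
| ExecSkip s : exec CSkip s 1 s
| ExecSetI a i j e s :
    exec (CSetI a i j e) s 1
      (Memory (update (idx s) a (ieval s i) (ieval s j) (ieval s e)) (num s))
| ExecSetV a i j e s :
    exec (CSetV a i j e) s 1
      (Memory (idx s) (update (num s) a (ieval s i) (ieval s j) (veval s e)))
| ExecSeq c1 c2 s1 s2 s3 t1 t2 :
    exec c1 s1 t1 s2 -> exec c2 s2 t2 s3 -> exec (CSeq c1 c2) s1 (t1 + t2)%N s3
| ExecIfTrue b c1 c2 s s' t :
    beval s b -> exec c1 s t s' -> exec (CIf b c1 c2) s t.+1 s'
| ExecIfFalse b c1 c2 s s' t :
    ~~ beval s b -> exec c2 s t s' -> exec (CIf b c1 c2) s t.+1 s'
| ExecWhileTrue b c s1 s2 s3 t1 t2 :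
    beval s1 b -> exec c s1 t1 s2 -> exec (CWhile b c) s2 t2 s3 ->
    exec (CWhile b c) s1 (t1 + t2).+1%N s3
| ExecWhileFalse b c s : ~~ beval s b -> exec (CWhile b c) s 1 s.

Definition mxcell (V : nmodType) (m n : nat) (M : 'M[V]_(m, n)) (i j : nat)
    : V :=
  match insub i, insub j with
  | Some i', Some j' => M i' j'
  | _, _ => 0
  end.

(* Naturals: array 0 holds m and n, array 1 the incidence matrix of the
   sets [S k]. Numbers: array 0 holds [A], array 1 the given solutions, one
   per row. All the other cells are zero. *)
Definition input_memory (R : realDomainType) (m n : nat) (A : 'M[int]_(m, n))
    (S : 'I_n.+1 -> {set 'I_m}) (X : 'M[R]_(n.+1, n)) : memory R :=
  Memory
    (fun a i j => match a, i, j with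
       | 0, 0, 0 => m
       | 0, 0, 1 => n
       | 1, _, _ => mxcell (\matrix_(k, l) (l \in S k : nat)) i j
       | _, _, _ => 0
       end%N)
    (fun a i j => match a with
       | 0%N => (mxcell A i j)%:~R
       | 1%N => mxcell X i j
       | _ => 0
       end).

Definition output_row (R : realDomainType) (n : nat) (s : memory R)
    : 'rV[R]_n :=
  \row_j num s 2 0 j.

(* Main.v *)
(* If the numbers l_k are such that, for every column j, the minimum x_j of
   X k j + l_k over the given solutions k is attained at least twice, then x
   solves A: any one k may be left out without changing x, and the set of
   solutions of a single row is closed under tropical combinations. So l is to
   solve a tropical system of n equations in n + 1 unknowns. Its equations are
   added one by one, keeping a spanning tree on the unknowns whose edges are the
   equations, the two ends of an edge attaining the minimum of its equation. The
   non-root node c carries the edge rho c to its parent pi c. A new equation is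
   attached at a node attaining its minimum, and the equations on the path from
   there to the root move one step up, which matches equations and unknowns
   perfectly. A new unknown with a large value then becomes the root, and the
   tree is regrown from it as in Dijkstra's algorithm: the unknowns in the tree
   are lowered together until an equation matched outside becomes tight at one
   of them. *)
Require Import Defs.
From HB Require Import structures.
From mathcomp Require Import all_boot all_order all_algebra.
From mathcomp Require Import zify lra.
Set Implicit Arguments.
Unset Strict Implicit.
Unset Printing Implicit Defensive.
Import Order.TTheory GRing.Theory Num.Theory.
Local Open Scope ring_scope.

(** * Step counts and a timed calculus of weakest preconditions *)

(** Bounds the number of steps when every run of a loop makes at most [M] rounds. Each round pays
    for its test and its body, and the final [.+1] pays for the test that fails. *)
Fixpoint cost (M : nat) (c : cmd) : nat :=
  match c with
  | CSkip | CSetI _ _ _ _ | CSetV _ _ _ _ => 1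
  | CSeq c1 c2 => cost M c1 + cost M c2
  | CIf _ c1 c2 => (cost M c1 + cost M c2).+1
  | CWhile _ c1 => ((cost M c1).+1 * M).+1
  end%N.

(** Rounds are bounded by ['X + 1] because the longest loops make [n + 1] of them, while the
    polynomial is to be evaluated at [m + n]. *)
Fixpoint cost_poly (c : cmd) : {poly nat} :=
  match c with
  | CSkip | CSetI _ _ _ _ | CSetV _ _ _ _ => 1
  | CSeq c1 c2 => cost_poly c1 + cost_poly c2
  | CIf _ c1 c2 => cost_poly c1 + cost_poly c2 + 1
  | CWhile _ c1 => (cost_poly c1 + 1) * ('X + 1) + 1
  end.

Lemma horner_cost_poly (M : nat) (c : cmd) :
  (cost_poly c).[M] = cost M.+1 c.
Proof.
elim: c => [|a e1 e2 e3|a e1 e2 e3|c1 IH1 c2 IH2|b c1 IH1 c2 IH2|b c IH] /=;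
  rewrite ?hornerD ?hornerM ?hornerD ?hornerX ?hornerC ?IH1 ?IH2 ?IH //=.
- by rewrite addrC.
- rewrite [(_ * _)%R]/(_ * _)%N ![(_ + _)%R]/(_ + _)%N; lia.
Qed.

(** Total correctness with a clock: termination within [cost M c] steps is part of the assertion. *)
Definition wp (R : realDomainType) (M : nat) (c : cmd)
    (Q : memory R -> Prop) (s : memory R) : Prop :=
  exists t s', [/\ exec c s t s', (t <= cost M c)%N & Q s'].

Section WeakestPreconditions.
Variables (R : realDomainType) (M : nat).
Implicit Types (s : memory R) (Q : memory R -> Prop).

Lemma wp_mono c Q Q' s :
  (forall s', Q s' -> Q' s') -> wp M c Q s -> wp M c Q' s.
Proof. by move=> QQ' [t [s' [ex le Qs]]]; exists t, s'; split=> //; exact: QQ'. Qed.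

Lemma wp_skip Q s : Q s -> wp M CSkip Q s.
Proof. by move=> Qs; exists 1%N, s; split=> //; constructor. Qed.

Lemma wp_setI a i j e Q s :
  Q (Memory (update (idx s) a (ieval s i) (ieval s j) (ieval s e)) (num s)) ->
  wp M (CSetI a i j e) Q s.
Proof. by move=> Qs; eexists 1%N, _; split; [constructor| |exact: Qs]. Qed.

Lemma wp_setV a i j e Q s :
  Q (Memory (idx s) (update (num s) a (ieval s i) (ieval s j) (veval s e))) ->
  wp M (CSetV a i j e) Q s.
Proof. by move=> Qs; eexists 1%N, _; split; [constructor| |exact: Qs]. Qed.

Lemma wp_seq c1 c2 Q s : wp M c1 (wp M c2 Q) s -> wp M (CSeq c1 c2) Q s.
Proof.
move=> [t1 [s1 [ex1 le1 [t2 [s2 [ex2 le2 Qs]]]]]].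
by exists (t1 + t2)%N, s2; split=> //=; [exact: ExecSeq ex1 ex2|exact: leq_add].
Qed.

Lemma wp_if b c1 c2 Q s :
  (beval s b -> wp M c1 Q s) -> (~~ beval s b -> wp M c2 Q s) ->
  wp M (CIf b c1 c2) Q s.
Proof.
case: (boolP (beval s b)) => Hb H1 H2.
  have [t [s' [ex le Qs]]] := H1 isT.
  by exists t.+1, s'; split=> //=; [exact: ExecIfTrue|lia].
have [t [s' [ex le Qs]]] := H2 isT.
by exists t.+1, s'; split=> //=; [exact: ExecIfFalse|lia].
Qed.

Lemma wp_while (I : memory R -> Prop) (mu : memory R -> nat) b c s :
  (forall s', I s' -> beval s' b ->
     wp M c (fun s2 => I s2 /\ (mu s2 < mu s')%N) s') ->
  I s -> (mu s <= M)%N ->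
  wp M (CWhile b c) (fun s' => I s' /\ ~~ beval s' b) s.
Proof.
move=> body Is leM.
(* The bound is first proved with [mu s] in place of [M], which is the form that an induction on the
   variant can use. *)
suff [t [s' [ex le Qs]]] : exists t s', [/\ exec (CWhile b c) s t s',
    (t <= ((cost M c).+1 * mu s).+1)%N & I s' /\ ~~ beval s' b].
  exists t, s'; split=> //=; apply: leq_trans le _.
  by rewrite ltnS leq_mul2l leM orbT.
have [k] := ubnP (mu s); elim: k s Is {leM} => // k IH s Is lt_k.
case: (boolP (beval s b)) => Hb; last first.
  by exists 1%N, s; split=> //; exact: ExecWhileFalse.
have [t1 [s1 [ex1 le1 [I1 lt1]]]] := body _ Is Hb.
have [|t2 [s2 [ex2 le2 Q2]]] := IH s1 I1; first by lia.
exists (t1 + t2).+1, s2; split=> //; first exact: ExecWhileTrue ex1 ex2.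
rewrite ltnS.
have : ((cost M c).+1 * (mu s1).+1 <= (cost M c).+1 * mu s)%N.
  by rewrite leq_mul2l lt1 orbT.
rewrite mulnS; lia.
Qed.

End WeakestPreconditions.

Local Notation "# k" := (ICst k) (at level 1).
Local Notation var a := (IGet a (ICst 0) (ICst 0)).
Local Notation set_var a e := (CSetI a (ICst 0) (ICst 0) e).
Local Notation "c1 ;; c2" := (CSeq c1 c2) (at level 90, right associativity).

Definition for_loop (a : nat) (e : iexp) (c : cmd) : cmd :=
  set_var a #0 ;;
  CWhile (BLeI (IAdd (var a) #1) e) (c ;; set_var a (IAdd (var a) #1)).

Definition set_idx (R : realDomainType) (a v : nat) (s : memory R) : memory R :=
  Memory (update (idx s) a 0 0 v) (num s).

(** The bound [e] is evaluated again in every round, so the invariant has to determine both the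
    counter and the value [N] of [e]. *)
Lemma wp_for (R : realDomainType) (M N : nat) (I : nat -> memory R -> Prop)
    (a : nat) (e : iexp) (c : cmd) (Q : memory R -> Prop) (s : memory R) :
  (N <= M)%N ->
  (forall q s', I q s' -> idx s' a 0 0 = q /\ ieval s' e = N) ->
  I 0 (set_idx a 0 s) ->
  (forall q s', (q < N)%N -> I q s' ->
     wp M c (fun s2 => idx s2 a 0 0 = q /\ I q.+1 (set_idx a q.+1 s2)) s') ->
  (forall s', I N s' -> Q s') ->
  wp M (for_loop a e c) Q s.
Proof.
move=> leNM rd I0 body IQ.
apply/wp_seq/wp_setI => /=.
apply: (wp_mono (Q := fun s' => (exists2 q, (q <= N)%N & I q s') /\
   ~~ beval s' (BLeI (IAdd (var a) #1) e))).
  move=> s' [[q leq Iq] /=]; have [-> ->] := rd _ _ Iq => ?.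
  by apply: IQ; have <- : q = N by lia.
apply: (wp_while (mu := fun s' => (N - idx s' a 0 0)%N)).
- move=> s' [q leq Iq] /=; have [Hq ->] := rd _ _ Iq; rewrite Hq => lt_q.
  apply: wp_seq; have := body q s' _ Iq; rewrite -addn1 => /(_ lt_q).
  apply: wp_mono => s2 [e2 I2]; apply: wp_setI => /=; rewrite e2.
  split; first by exists (q + 1)%N.
  by rewrite /update !eqxx /=; lia.
- by exists 0.
- by rewrite /=; lia.
Qed.

(** This is what [update] computes to once the array and its first subscript are fixed, so writes in
    memory match it by conversion. *)
Definition upd (T : Type) (f : nat -> T) (c : nat) (v : T) : nat -> T :=
  fun j => if j == c then v else f j.

(** * Matchings and spanning trees of tight equations *)

Section TightTrees.
Variables (R : realDomainType) (B : nat -> nat -> R).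
Implicit Types (y : nat -> R) (rho pi rk : nat -> nat).

Definition tight y (N j c : nat) : Prop :=
  forall k, (k <= N)%N -> B c j + y c <= B k j + y k.

(** How far the unknown [k] can be lowered, [c] staying fixed, before it ties with [c] in the
    equation [rho c]. *)
Definition slack rho y (c k : nat) : R :=
  B k (rho c) + y k - (B c (rho c) + y c).

(** [D] counts the matched pairs and [N] is the last unknown. In a tree [D = N], the root being
    unmatched; once a new equation has been absorbed, [D = N.+1]. *)
Record matching (D N : nat) rho y : Prop := Matching {
  mt_lt : forall c, (c < D)%N -> (rho c < D)%N;
  mt_inj : forall c d, (c < D)%N -> (d < D)%N -> rho c = rho d -> c = d;
  mt_tight : forall c, (c < D)%N -> tight y N (rho c) c }.

(* A partially grown tree: [rk c] is [0] outside of it, and otherwise the rank of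
   [c] in the order of insertion, starting with [rk N = 1] for the root. *)
Record tree (N t : nat) rho pi rk y : Prop := Tree {
  tr_matching : matching N N rho y;
  tr_root : (0 < rk N)%N;
  tr_rk : forall c, (c <= N)%N -> (rk c <= t.+1)%N;
  tr_parent : forall c, (c < N)%N -> (0 < rk c)%N ->
    [/\ pi c <= N, 0 < rk (pi c) & rk (pi c) < rk c]%N;
  tr_tight : forall c, (c < N)%N -> (0 < rk c)%N -> tight y N (rho c) (pi c);
  tr_count : (\sum_(c < N) (0 < rk c) = t)%N }.

Lemma tree_full N rho pi rk y c :
  tree N N rho pi rk y -> (c < N)%N -> (0 < rk c)%N.
Proof.
move=> [_ _ _ _ _ cnt] lt_c; rewrite lt0n; apply/negP => /eqP rk0.
have : (\sum_(c < N) (0 < rk c) < \sum_(c < N) 1)%N.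
  rewrite (bigD1 (Ordinal lt_c)) //= [X in (_ < X)%N](bigD1 (Ordinal lt_c)) //=.
  by rewrite rk0 add0n add1n ltnS; apply: leq_sum => i _; exact: leq_b1.
by rewrite cnt sum1_card card_ord ltnn.
Qed.

Lemma tree_partial N t rho pi rk y :
  tree N t rho pi rk y -> (t < N)%N -> exists2 c, (c < N)%N & rk c = 0%N.
Proof.
move=> [_ _ _ _ _ cnt] lt_t.
have /existsP[c /eqP rkc] : [exists c : 'I_N, rk c == 0%N].
  apply: contraTT lt_t; rewrite negb_exists => /forallP pos.
  rewrite -leqNgt -cnt -{1}[N]card_ord -sum1_card.
  by apply: leq_sum => i _; case: (rk i) (pos i).
by exists c.
Qed.

(* While equations move up the path, [rho N] holds the one in transit, which is
   tight at [cur]. *)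
Record walk (N : nat) rho pi rk y (cur : nat) : Prop := Walk {
  wk_lt : forall c, (c <= N)%N -> (rho c <= N)%N;
  wk_inj : forall c d, (c <= N)%N -> (d <= N)%N -> rho c = rho d -> c = d;
  wk_tight : forall c, (c < N)%N -> tight y N (rho c) c;
  wk_cur : tight y N (rho N) cur;
  wk_cur_le : (cur <= N)%N;
  wk_parent : forall c, (c < N)%N -> (pi c <= N)%N /\ (rk (pi c) < rk c)%N;
  wk_tight_parent : forall c, (c < N)%N -> (rk c <= rk cur)%N ->
    tight y N (rho c) (pi c) }.

(** The root [N] carries no equation, so its cell can hold the new equation [N]; the equations
    matched before are all smaller than [N]. *)
Lemma walk_start N rho pi rk y cur :
  tree N N rho pi rk y -> (cur <= N)%N -> tight y N N cur ->
  walk N (upd rho N N) pi rk y cur.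
Proof.
move=> tr le_cur tg; have pos := tree_full tr.
have [[lt inj tgm] _ _ par tgp _] := tr.
split=> //; rewrite /upd ?eqxx //.
- by move=> c le_c; case: eqP => // ?; apply/ltnW/lt; lia.
- move=> c d le_c le_d; case: eqP => [->|ne_c]; case: eqP => [->|ne_d] //.
  + by have := lt d; lia.
  + by have := lt c; lia.
  + by apply: inj; lia.
- by move=> c lt_c; rewrite ltn_eqF //; exact: tgm.
- by move=> c lt_c; have [|] := par c lt_c => //; exact: pos.
- by move=> c lt_c _; rewrite ltn_eqF //; apply: tgp => //; exact: pos.
Qed.

(** The equation in transit settles at [cur], where it is tight. The one that [cur] carried replaces
    it in transit; as a tree edge, it is tight at [pi cur]. *)
Lemma walk_step N rho pi rk y cur :
  walk N rho pi rk y cur -> (cur < N)%N ->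
  walk N (upd (upd rho cur (rho N)) N (rho cur)) pi rk y (pi cur).
Proof.
move=> [le inj tg tgc lec par tgp] lt_cur.
have [le_pi lt_rk] := par _ lt_cur.
split=> //; rewrite /upd ?eqxx //.
- by move=> c le_c; case: eqP => [_|_]; [exact: le|case: eqP => _; exact: le].
(* The new map is [rho] composed with the transposition of [cur] and [N]. *)
- move=> c d le_c le_d.
  case: (c =P N) => [->|ne_c]; case: (d =P N) => [->|ne_d] //.
  + case: eqP => [->|ne] E; first by have := inj _ _ lec (leqnn N) E; lia.
    by have := inj _ _ lec le_d E; lia.
  + case: eqP => [->|ne] E; first by have := inj _ _ (leqnn N) lec E; lia.
    by have := inj _ _ le_c lec E; lia.
  + case: (c =P cur) => [->|nc]; case: (d =P cur) => [->|nd] // E.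
    * by have := inj _ _ (leqnn N) le_d E; lia.
    * by have := inj _ _ le_c (leqnn N) E; lia.
    * exact: inj.
- move=> c lt_c; rewrite ltn_eqF //; case: eqP => [->|_]; [exact: tgc|exact: tg].
- exact: tgp.
(* Only the edge at [cur] has changed, and the rank of [cur] exceeds that of [pi cur]. *)
- move=> c lt_c rk_c; rewrite ltn_eqF //; case: eqP => [E|_]; last by apply: tgp; lia.
  by move: rk_c lt_rk; rewrite E; lia.
Qed.

(** At the root the equation in transit is already in place, its cell being that of the root. *)
Lemma walk_end N rho pi rk y cur :
  walk N rho pi rk y cur -> (N <= cur)%N -> matching N.+1 N rho y.
Proof.
move=> [le inj tg tgc lec _ _] ge_cur.
have E : cur = N by lia.
split=> [c|c d|c]; rewrite ?ltnS; [exact: le|exact: inj|].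
by rewrite leq_eqVlt => /orP[/eqP->|/tg //]; rewrite -{3}E.
Qed.

(** A new unknown large enough not to undercut any matched minimum leaves the matching tight, and
    becomes the one-node tree. *)
Lemma tree_start N rho pi rk y y' :
  matching N.+1 N rho y ->
  (forall c, (c <= N)%N -> y' c = y c) ->
  (forall c, (c <= N)%N -> B c (rho c) + y' c <= B N.+1 (rho c) + y' N.+1) ->
  (forall c, (c <= N)%N -> rk c = 0%N) -> rk N.+1 = 1%N ->
  tree N.+1 0 rho pi rk y'.
Proof.
move=> [lt inj tg] yy new rk0 rk1.
split.
- split=> // c lt_c k; rewrite leq_eqVlt => /orP[/eqP->|]; first exact: new.
  by rewrite ltnS => le_k; rewrite !yy //; exact: tg.
- by rewrite rk1.
- by move=> c; rewrite leq_eqVlt => /orP[/eqP->|/rk0 ->]; rewrite ?rk1.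
- by move=> c /rk0 ->.
- by move=> c /rk0 ->.
- by rewrite big1 // => c _; rewrite rk0 // -ltnS.
Qed.

(** One round of Dijkstra's algorithm: all unknowns in the tree are lowered by the least slack,
    which makes [rho cur] tight at [kk] and lets [cur] be attached below [kk]. *)
Lemma tree_step N t rho pi rk y y' cur kk :
  tree N t rho pi rk y ->
  (cur < N)%N -> rk cur = 0%N -> (kk <= N)%N -> (0 < rk kk)%N ->
  (forall c k, (c < N)%N -> (k <= N)%N -> rk c = 0%N -> (0 < rk k)%N ->
     slack rho y cur kk <= slack rho y c k) ->
  (forall k, (k <= N)%N ->
     y' k = if (0 < rk k)%N then y k - slack rho y cur kk else y k) ->
  tree N t.+1 rho (upd pi cur kk) (upd rk cur t.+2) y'.
Proof.
move=> [[lt inj tg] root rkt par tgp cnt] lt_cur rk_cur le_kk rk_kk min yE.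
set w := slack _ _ _ _ in min yE.
have w0 : 0 <= w by rewrite subr_ge0; exact: tg.
(* A minimum attained in the tree persists: no unknown drops by more than [w], and those in the tree
   drop by exactly [w]. *)
have attached j k : (k <= N)%N -> (0 < rk k)%N -> tight y N j k -> tight y' N j k.
  move=> le_k rk_k tjk l le_l; rewrite !yE // rk_k.
  by have := tjk l le_l; case: ifP => _; lra.
(* For [c] outside the tree, minimality of [w] keeps the lowered unknowns from undercutting [c]. *)
have tg' c : (c < N)%N -> tight y' N (rho c) c.
  move=> lt_c; have le_c := ltnW lt_c.
  case: (posnP (rk c)) => [rk_c|rk_c]; last by apply: attached => //; exact: tg.
  move=> k le_k; rewrite !yE // rk_c /=; case: ifP => rk_k; last exact: tg.
  have := min c k lt_c le_k rk_c rk_k; rewrite /w /slack; lra.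
split.
- by [].
- by rewrite /upd gtn_eqF.
- by move=> c le_c; rewrite /upd; case: eqP => // _; have := rkt c le_c; lia.
- move=> c lt_c; rewrite /upd; case: (c =P cur) => [_ _|ne rk_c].
    by case: (kk =P cur) => [E|_]; [move: rk_kk; rewrite E rk_cur|split=> //; exact: rkt].
  have [le_pi rk_pi lt_pi] := par c lt_c rk_c.
  by split=> //; case: eqP => E //; move: rk_pi; rewrite E rk_cur.
(* After the shift [kk] and [cur] give the same value in the equation [rho cur]. *)
- move=> c lt_c; rewrite /upd; case: (c =P cur) => [-> _|ne rk_c].
    move=> k le_k; have := tg' cur lt_cur k le_k.
    rewrite (yE cur) ?(ltnW lt_cur) // (yE kk) // rk_cur rk_kk /= /w /slack; lra.
  have [le_pi rk_pi lt_pi] := par c lt_c rk_c.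
  by apply: attached => //; exact: tgp.
- rewrite -cnt (bigD1 (Ordinal lt_cur)) //= [in RHS](bigD1 (Ordinal lt_cur)) //=.
  rewrite /upd eqxx rk_cur add1n add0n; congr _.+1; apply: eq_bigr => i ne_i.
  by case: eqP => // E; move: ne_i; rewrite -val_eqE /= E eqxx.
Qed.

End TightTrees.

(** * The program *)

(* Scalars are 2 = r, 3 = c, 4 = k, 5 = cur, 6 = kk, 7 = t, 8 = a temporary;
   index arrays are 9 = rho, 10 = pi, 11 = rk; number arrays are 1 = B (the
   given solutions), 2 = the output, 3 = y, and 4 = the scalar delta. *)
Local Notation r_ := (var 2).
Local Notation c_ := (var 3).
Local Notation k_ := (var 4).
Local Notation cur_ := (var 5).
Local Notation kk_ := (var 6).
Local Notation rho_ c := (IGet 9 (ICst 0) c).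
Local Notation pi_ c := (IGet 10 (ICst 0) c).
Local Notation rk_ c := (IGet 11 (ICst 0) c).
Local Notation succ e := (IAdd e (ICst 1)).
Local Notation entry c j := (VAdd (VGet 1 c j) (VGet 3 (ICst 0) c)).
Local Notation slack_ c k := (VSub (entry k (rho_ c)) (entry c (rho_ c))).

Definition argmin_row : cmd :=
  set_var 5 #0 ;;
  for_loop 3 (succ r_)
    (CIf (BLeV (entry cur_ r_) (entry c_ r_)) CSkip (set_var 5 c_)).

Definition reroot : cmd :=
  CSetI 9 #0 r_ r_ ;;
  CWhile (BNot (BLeI r_ cur_))
    (set_var 8 (rho_ cur_) ;;
     CSetI 9 #0 cur_ (rho_ r_) ;;
     CSetI 9 #0 r_ (var 8) ;;
     set_var 5 (pi_ cur_)).

(** Zeroing the ranks dissolves the old tree while [rho] is kept as a matching. The value of the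
    unknown [r + 1] is only ever raised. *)
Definition new_root : cmd :=
  for_loop 3 (succ r_)
    (CSetI 11 #0 c_ #0 ;;
     CIf (BLeV (entry c_ (rho_ c_)) (entry (succ r_) (rho_ c_))) CSkip
       (CSetV 3 #0 (succ r_)
          (VSub (entry c_ (rho_ c_)) (VGet 1 (succ r_) (rho_ c_))))) ;;
  CSetI 11 #0 (succ r_) #1.

(* The value [cur = r + 1], the root, means that no candidate was seen yet. *)
Definition min_slack : cmd :=
  set_var 5 (succ r_) ;;
  for_loop 3 (succ r_)
    (CIf (BLeI (rk_ c_) #0)
      (for_loop 4 (succ (succ r_))
        (CIf (BAnd (BLeI #1 (rk_ k_))
                (BNot (BAnd (BNot (BLeI (succ r_) cur_))
                         (BLeV (slack_ cur_ kk_) (slack_ c_ k_)))))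
          (set_var 5 c_ ;; set_var 6 k_) CSkip))
      CSkip).

(** The slack is saved beforehand, because lowering the unknown [kk] changes it. *)
Definition shift_tree : cmd :=
  CSetV 4 #0 #0 (slack_ cur_ kk_) ;;
  for_loop 4 (succ (succ r_))
    (CIf (BLeI #1 (rk_ k_))
       (CSetV 3 #0 k_ (VSub (VGet 3 #0 k_) (VGet 4 #0 #0))) CSkip).

(** The node attached in round [t] gets rank [t + 2], the root having rank 1 and the rounds counting
    from 0. *)
Definition grow : cmd :=
  for_loop 7 (succ r_)
    (min_slack ;; shift_tree ;; CSetI 10 #0 cur_ kk_ ;;
     CSetI 11 #0 cur_ (IAdd (var 7) #2)).

Definition output : cmd :=
  for_loop 2 (IGet 0 #0 #1)
    (CSetV 2 #0 r_ (entry #0 r_) ;;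
     for_loop 3 (succ (IGet 0 #0 #1))
       (CIf (BLeV (VGet 2 #0 r_) (entry c_ r_)) CSkip
          (CSetV 2 #0 r_ (entry c_ r_)))).

Definition solver : cmd :=
  CSetI 11 #0 #0 #1 ;;
  for_loop 2 (IGet 0 #0 #1) (argmin_row ;; reroot ;; new_root ;; grow) ;;
  output.

(** * Correctness of the program *)

Section Correctness.
Variables (R : realDomainType) (M n : nat) (B : nat -> nat -> R).
Implicit Types (s : memory R) (y : nat -> R) (rho pi rk : nat -> nat).
Hypothesis le_nM : (n < M)%N.

Record state r rho pi rk y s : Prop := State {
  st_n : idx s 0 0 1 = n;
  st_r : idx s 2 0 0 = r;
  st_rho : idx s 9 0 = rho;
  st_pi : idx s 10 0 = pi;
  st_rk : idx s 11 0 = rk;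
  st_B : num s 1 = B;
  st_y : num s 3 0 = y }.

Lemma argmin_row_ok r rho pi rk y s :
  (r < n)%N -> state r rho pi rk y s ->
  wp M argmin_row (fun s' => [/\ state r rho pi rk y s',
    (idx s' 5 0 0 <= r)%N & tight B y r r (idx s' 5 0 0)]) s.
Proof.
move=> lt_r st; apply/wp_seq/wp_setI => /=.
apply: (wp_for (N := (r + 1)%N) (I := fun q s' => [/\ idx s' 3 0 0 = q,
  state r rho pi rk y s', (idx s' 5 0 0 <= r)%N &
  forall k, (k < q)%N ->
    B (idx s' 5 0 0) r + y (idx s' 5 0 0) <= B k r + y k])).
- lia.
- by move=> q s' [eq st' _ _] /=; rewrite (st_r st').
- by split=> //; case: st => *; split.
- move=> q s' lt_q [eq st' le_cur min].
  have [_ er _ _ _ eB ey] := st'.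
  apply: wp_if => /=; rewrite er eB ey eq => H.
    apply: wp_skip; split=> //; split=> //; first by case: st' => *; split.
    by move=> k; rewrite ltnS leq_eqVlt => /orP[/eqP->|/min].
  apply: wp_setI => /=; rewrite eq; split=> //; split=> //=.
  - by case: st' => *; split.
  - by rewrite -[X in (X <= _)%N]/(q); lia.
  - move=> k; rewrite ltnS leq_eqVlt => /orP[/eqP-> //|/min]; apply: le_trans.
    by move: H; rewrite -ltNge => /ltW.
- move=> s' [eq st' le_cur min]; split=> // k le_k; apply: min; lia.
Qed.

Lemma reroot_ok r rho pi rk y s :
  (r < n)%N -> state r rho pi rk y s -> tree B r r rho pi rk y ->
  (idx s 5 0 0 <= r)%N -> tight B y r r (idx s 5 0 0) ->
  wp M reroot (fun s' => exists2 rho', state r rho' pi rk y s' &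
    matching B r.+1 r rho' y) s.
Proof.
move=> lt_r st tr le_cur tg; have [_ er _ _ _ _ _] := st.
apply/wp_seq/wp_setI => /=; rewrite er.
(* The variant is the rank of the current node: it falls strictly towards the root and is at most
   [r + 1] at the start. *)
apply: wp_mono (wp_while
  (I := fun s' => exists2 rho', state r rho' pi rk y s' &
    walk B r rho' pi rk y (idx s' 5 0 0))
  (mu := fun s' => rk (idx s' 5 0 0)) _ _ _).
- move=> s' [[rho' st' wk]] /=; rewrite negbK (st_r st') => end_.
  by exists rho' => //; exact: walk_end wk end_.
- move=> s' [rho' st' wk] /=; rewrite (st_r st') -ltnNge => lt_cur.
  apply/wp_seq/wp_setI/wp_seq/wp_setI/wp_seq/wp_setI/wp_setI => /=.
  have [en er' erho epi erk eB ey] := st'.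
  set cur := idx s' 5 0 0 in lt_cur wk *.
  split; last first.
    rewrite -[X in (rk X < _)%N]/(idx s' 10 0 cur) epi.
    by have [] := wk_parent wk lt_cur.
  exists (upd (upd rho' cur (rho' r)) r (rho' cur)).
    by split=> //=; rewrite /update /= er' erho.
  rewrite -[X in walk _ _ _ _ _ _ X]/(idx s' 10 0 cur) epi.
  exact: walk_step.
- exists (upd rho r r); last exact: walk_start.
  by case: st => ? ? <- *; split.
- rewrite /=; have := tr_rk tr le_cur; rewrite -[X in rk X]/(idx s 5 0 0).
  lia.
Qed.

Lemma new_root_ok r rho pi rk y s :
  (r < n)%N -> state r rho pi rk y s -> matching B r.+1 r rho y ->
  wp M new_root (fun s' => exists rk' y', state r rho pi rk' y' s' /\
    tree B r.+1 0 rho pi rk' y') s.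
Proof.
move=> lt_r st mt; apply: wp_seq.
apply: (wp_for (N := (r + 1)%N) (I := fun q s' => idx s' 3 0 0 = q /\
  exists rk' y', [/\ state r rho pi rk' y' s',
    forall c, (c <= r)%N -> y' c = y c,
    forall c, (c < q)%N -> rk' c = 0%N &
    forall c, (c < q)%N ->
      B c (rho c) + y' c <= B r.+1 (rho c) + y' r.+1])).
- lia.
- by move=> q s' [eq [rk' [y' [st' _ _ _]]]] /=; rewrite (st_r st').
- split=> //; exists rk, y; split=> //; by case: st => *; split.
- move=> q s' lt_q [eq [rk' [y' [st' yy rk0 new]]]].
  apply/wp_seq/wp_setI => /=.
  have [_ er erho _ erk eB ey] := st'.
  apply: wp_if => /=.
    rewrite /update /= er erho eB ey eq addn1 => H.
    apply: wp_skip; split=> //; split=> //.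
    exists (upd rk' q 0%N), y'; split=> //.
    + by case: st' => ? ? ? ? <- *; split.
    + move=> c; rewrite ltnS leq_eqVlt /upd; case: eqP => //= _; exact: rk0.
    + by move=> c; rewrite ltnS leq_eqVlt => /orP[/eqP->|/new].
  rewrite /update /= er erho eB ey eq addn1 -ltNge => H.
  apply: wp_setV; split=> //; split=> //.
  (* With this value the new unknown ties with [q] in the equation [rho q]. It exceeds the old
     value, so the inequalities obtained so far survive. *)
  set v := B q (rho q) + y' q - B r.+1 (rho q).
  exists (upd rk' q 0%N), (upd y' r.+1 v).
  have lt_v : y' r.+1 < v by rewrite /v; lra.
  split.
  + split=> //=; try by case: st'.
      by rewrite /update /= erk.
    by rewrite /update /= er erho eB ey eq addn1.
  + by move=> c le_c; rewrite /upd ltn_eqF // yy.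
  + move=> c; rewrite ltnS leq_eqVlt /upd; case: eqP => //= _; exact: rk0.
  + move=> c; rewrite ltnS leq_eqVlt /upd eqxx => /orP[/eqP->|lt_c].
      by rewrite ltn_eqF ?/v; [lra|lia].
    by rewrite ltn_eqF; [have := new c lt_c; lra|lia].
- move=> s' [eq [rk' [y' [st' yy rk0 new]]]].
  have [_ er _ _ erk _ _] := st'.
  apply: wp_setI; exists (upd rk' r.+1 1%N), y'; split.
    case: st' => *; split=> //=; by rewrite er addn1 /update /= erk.
  apply: (tree_start _ mt yy).
  + by move=> c le_c; apply: new; lia.
  + by move=> c le_c; rewrite /upd ltn_eqF // rk0 // addn1.
  + by rewrite /upd eqxx.
Qed.

(** [P] describes the pairs scanned so far. A candidate joins an unknown outside the tree to one
    inside, and [best_min] excludes the dummy [cur = N] once a candidate was scanned. *)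
Record best N rho rk y (P : nat -> nat -> Prop) (cur kk : nat) : Prop := Best {
  best_valid : (cur < N)%N -> [/\ rk cur = 0, kk <= N & 0 < rk kk]%N;
  best_min : forall c k, (c < N)%N -> (k <= N)%N -> rk c = 0%N ->
    (0 < rk k)%N -> P c k ->
    (cur < N)%N /\ slack B rho y cur kk <= slack B rho y c k }.

Lemma best_sub N rho rk y (P P' : nat -> nat -> Prop) cur kk :
  (forall c k, (c < N)%N -> (k <= N)%N -> rk c = 0%N -> (0 < rk k)%N ->
    P' c k -> P c k) ->
  best N rho rk y P cur kk -> best N rho rk y P' cur kk.
Proof.
by move=> sub [val min]; split=> // c k *; apply: min => //; exact: sub.
Qed.

Lemma min_slack_ok t r rho pi rk y s :
  (r < n)%N -> state r rho pi rk y s -> tree B r.+1 t rho pi rk y ->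
  (t < r.+1)%N -> idx s 7 0 0 = t ->
  wp M min_slack (fun s' => [/\ state r rho pi rk y s',
    (idx s' 5 0 0 < r.+1)%N, idx s' 7 0 0 = t &
    best r.+1 rho rk y (fun _ _ => True) (idx s' 5 0 0) (idx s' 6 0 0)]) s.
Proof.
move=> lt_r st tr lt_t et; apply/wp_seq/wp_setI => /=; rewrite (st_r st).
apply: (wp_for (N := (r + 1)%N) (I := fun q s' => [/\ idx s' 3 0 0 = q,
  state r rho pi rk y s', idx s' 7 0 0 = t &
  best r.+1 rho rk y (fun c _ => (c < q)%N) (idx s' 5 0 0) (idx s' 6 0 0)])).
- lia.
- by move=> q s' [eq st' _ _] /=; rewrite (st_r st').
- split=> //; first by case: st => *; split.
  split=> //; by rewrite -[X in (X < _)%N]/(r + 1)%N addn1 ltnn.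
- move=> q s' lt_q [eq st' et' bst].
  apply: wp_if => /=; rewrite (st_rk st') eq => rk_q; last first.
    apply: wp_skip; split=> //; split=> //; first by case: st' => *; split.
    apply: best_sub bst => c k _ _ rk_c _; rewrite ltnS leq_eqVlt.
    by case/orP => // /eqP E; move: rk_q; rewrite -E rk_c.
  apply: (wp_for (N := (r + 1 + 1)%N) (I := fun p s' => [/\ idx s' 4 0 0 = p,
    idx s' 3 0 0 = q, state r rho pi rk y s', idx s' 7 0 0 = t &
    best r.+1 rho rk y (fun c k => (c < q)%N \/ c = q /\ (k < p)%N)
      (idx s' 5 0 0) (idx s' 6 0 0)])).
  + lia.
  + by move=> p s2 [ep _ st2 _ _] /=; rewrite (st_r st2).
  + split=> //; first by case: st' => *; split.
    by apply: best_sub bst => c k _ _ _ _ [//|[]].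
  + move=> p s2 lt_p [ep eq2 st2 et2 [val min]].
    have [_ er erho _ erk eB ey] := st2.
    apply: wp_if => /=; rewrite er erho erk eB ey ep eq2 addn1.
    * move=> /andP[rk_p H]; apply/wp_seq/wp_setI/wp_setI => /=.
      rewrite /update /= ep eq2; split=> //; split=> //.
        by case: st2 => *; split.
      rewrite -[X in best _ _ _ _ _ X _]/(q) -[X in best _ _ _ _ _ _ X]/(p).
      split=> [_|c k lt_c le_k rk_c rk_k Pck]; first by split=> //; lia.
      split; first by lia.
      (* An earlier candidate is no better than the former record, which the pair [q], [p] has just
         beaten. *)
      have old : (c < q)%N \/ c = q /\ (k < p)%N ->
          slack B rho y q p <= slack B rho y c k.
        move=> /(min _ _ lt_c le_k rk_c rk_k)[lt_cur]; apply: le_trans.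
        move: H; rewrite -ltnNge lt_cur /= -ltNge; exact: ltW.
      case: Pck => [?|[Ec]]; first by apply: old; left.
      rewrite ltnS leq_eqVlt => /orP[/eqP->|?]; first by rewrite Ec.
      by apply: old; right.
    * move=> H; apply: wp_skip; split=> //; split=> //.
        by case: st2 => *; split.
      split=> // c k lt_c le_k rk_c rk_k [?|[Ec]].
        by apply: min => //; left.
      rewrite ltnS leq_eqVlt => /orP[/eqP Ek|lt_k]; last first.
        by apply: min => //; right.
      by move: H; rewrite Ec Ek in rk_k *; rewrite rk_k /= negbK -ltnNge => /andP.
  + move=> s2 [ep eq2 st2 et2 bst2]; split=> //; split=> //.
      by case: st2 => *; split.
    apply: best_sub bst2 => c k _ le_k _ _; rewrite ltnS leq_eqVlt.
    by case/orP => [/eqP->|]; [right; split=> //; lia|left].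
- move=> s' [eq st' et' bst].
  (* Some unknown is still outside the tree; paired with the root it is a candidate, so [cur] is no
     longer the dummy. *)
  have [c lt_c rk_c] := tree_partial tr lt_t.
  split=> //; last by apply: best_sub bst => c' k' ? *; lia.
  have [] // := best_min bst lt_c (leqnn r.+1) rk_c (tr_root tr).
  by rewrite addn1.
Qed.

Lemma shift_tree_ok t r rho pi rk y s :
  (r < n)%N -> state r rho pi rk y s -> idx s 7 0 0 = t ->
  wp M shift_tree (fun s' => [/\ idx s' 7 0 0 = t,
    idx s' 5 0 0 = idx s 5 0 0, idx s' 6 0 0 = idx s 6 0 0 &
    exists2 y', state r rho pi rk y' s' &
      forall k, (k <= r.+1)%N -> y' k = if (0 < rk k)%N
        then y k - slack B rho y (idx s 5 0 0) (idx s 6 0 0) else y k]) s.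
Proof.
move=> lt_r st et; have [_ er erho _ erk eB ey] := st.
set w := slack _ _ _ _ _.
apply/wp_seq/wp_setV.
apply: (wp_for (N := (r + 1 + 1)%N) (I := fun q s' => [/\ idx s' 4 0 0 = q,
  idx s' 7 0 0 = t, (idx s' 5 0 0, idx s' 6 0 0) = (idx s 5 0 0, idx s 6 0 0),
  num s' 4 0 0 = w &
  exists2 y', state r rho pi rk y' s' & forall k,
    y' k = if (k < q)%N && (0 < rk k)%N then y k - w else y k])).
- lia.
- by move=> q s' [eq _ _ _ [y' st' _]] /=; rewrite (st_r st').
- split=> //=; last by exists y => //; case: st => *; split.
  by rewrite /update /= erho eB ey.
- move=> q s' lt_q [eq et' ecur ew [y' st' yE]].
  have [_ _ _ _ erk' _ ey'] := st'.
  apply: wp_if => /=; rewrite erk' eq => rk_q.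
    apply: wp_setV; split=> //; split=> //.
    exists (upd y' q (y' q - w)).
      by case: st' => *; split=> //=; rewrite /update /= eq ey' ew.
    move=> k; rewrite /upd ltnS leq_eqVlt; case: (k =P q) => [->|_] /=.
      by rewrite rk_q yE ltnn.
    exact: yE.
  apply: wp_skip; split=> //; split=> //.
  exists y'; first by case: st' => *; split.
  move=> k; rewrite ltnS leq_eqVlt; case: (k =P q) => [->|_] /=; last exact: yE.
  by rewrite (negbTE rk_q) yE ltnn.
- move=> s' [eq et' [-> ->] ew [y' st' yE]]; split=> //; exists y' => // k le_k.
  by rewrite yE; have -> : (k < r + 1 + 1)%N by lia.
Qed.

Lemma grow_ok r rho pi rk y s :
  (r < n)%N -> state r rho pi rk y s -> tree B r.+1 0 rho pi rk y ->
  wp M grow (fun s' => exists pi' rk' y', state r rho pi' rk' y' s' /\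
    tree B r.+1 r.+1 rho pi' rk' y') s.
Proof.
move=> lt_r st tr.
apply: (wp_for (N := (r + 1)%N) (I := fun q s' => idx s' 7 0 0 = q /\
  exists pi' rk' y', state r rho pi' rk' y' s' /\
    tree B r.+1 q rho pi' rk' y')).
- lia.
- by move=> q s' [eq [? [? [? [st' _]]]]] /=; rewrite (st_r st').
- by split=> //; exists pi, rk, y; split=> //; case: st => *; split.
- move=> q s1 lt_q [e1 [pi1 [rk1 [y1 [st1 tr1]]]]].
  apply: wp_seq; rewrite addn1 in lt_q.
  apply: wp_mono (min_slack_ok lt_r st1 tr1 lt_q e1) => s2 [st2 lt_cur e2 bst].
  apply: wp_seq; apply: wp_mono (shift_tree_ok lt_r st2 e2).
  move=> s3 [e3 ecur ekk [y3 st3 yE]].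
  have [rk_cur le_kk rk_kk] := best_valid bst lt_cur.
  apply/wp_seq/wp_setI/wp_setI; split=> //; split=> //.
  exists (upd pi1 (idx s2 5 0 0) (idx s2 6 0 0)),
    (upd rk1 (idx s2 5 0 0) q.+2), y3; split.
    by case: st3 => ? ? ? <- <- *; split=> //=;
      rewrite /update /= ?e3 ?addn2 ecur ?ekk.
  apply: tree_step tr1 lt_cur rk_cur le_kk rk_kk _ yE => c k lt_c le_k rk_c rk_k.
  by have [] := best_min bst lt_c le_k rk_c rk_k I.
- by move=> s' [_]; rewrite addn1.
Qed.

Definition attained_min y (j : nat) (v : R) : Prop :=
  (forall c, (c <= n)%N -> v <= B c j + y c) /\
  exists2 c, (c <= n)%N & v = B c j + y c.

Lemma output_ok r rho pi rk y s :
  state r rho pi rk y s ->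
  wp M output (fun s' => forall j, (j < n)%N ->
    attained_min y j (num s' 2 0 j)) s.
Proof.
move=> st; apply: (wp_for (N := n) (I := fun q s' => [/\ idx s' 2 0 0 = q,
  state q rho pi rk y s' &
  forall j, (j < q)%N -> attained_min y j (num s' 2 0 j)])).
- exact: ltnW.
- by move=> q s' [eq st' _] /=; rewrite (st_n st').
- by split=> //; case: st => *; split.
- move=> q s' lt_q [eq st' out].
  have [_ er _ _ _ eB ey] := st'.
  apply/wp_seq/wp_setV => /=; rewrite er.
  apply: (wp_for (N := (n + 1)%N) (I := fun p s2 => [/\ idx s2 3 0 0 = p,
    state q rho pi rk y s2,
    forall j, (j < q)%N -> attained_min y j (num s2 2 0 j),
    forall c, (c < p)%N -> num s2 2 0 q <= B c q + y c &
    exists2 c, (c <= n)%N & num s2 2 0 q = B c q + y c])).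
  + lia.
  + by move=> p s2 [ep st2 _ _ _] /=; rewrite (st_n st2).
  + split=> //=; first by case: st' => *; split.
      by move=> j lt_j; rewrite /update /= ltn_eqF //; exact: out.
    by exists 0%N => //; rewrite /update /= eqxx eB ey.
  + move=> p s2 lt_p [ep st2 out2 le2 [c0 le_c0 at2]].
    have [_ er2 _ _ _ eB2 ey2] := st2.
    apply: wp_if => /=; rewrite er2 eB2 ey2 ep => H.
      apply: wp_skip; split=> //; split=> //; first by case: st2 => *; split.
      - by move=> c; rewrite ltnS leq_eqVlt => /orP[/eqP->|/le2].
      - by exists c0.
    apply: wp_setV => /=; rewrite er2 eB2 ey2 ep; split=> //; split=> //=.
    * by case: st2 => *; split.
    * by move=> j lt_j; rewrite /update /= ltn_eqF //; exact: out2.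
    * move=> c; rewrite /update /= eqxx ltnS leq_eqVlt => /orP[/eqP-> //|/le2].
      by apply: le_trans; move: H; rewrite -ltNge => /ltW.
    * by exists p; [lia|rewrite /update /= eqxx].
  + move=> s2 [ep st2 out2 le2 at2]; split; first by case: st2.
    split=> //; first by case: st2 => *; split.
    move=> j; rewrite ltnS leq_eqVlt => /orP[/eqP->|/out2 //]; split=> //.
    by move=> c le_c; apply: le2; lia.
- by move=> s' [].
Qed.

(** The equation [j] is the edge carried by a single non-root node, and it is tight at both ends of
    that edge. *)
Lemma tree_two_minima rho pi rk y j v :
  tree B n n rho pi rk y -> (j < n)%N -> attained_min y j v ->
  exists c d, [/\ (c <= n)%N, (d <= n)%N, c <> d, v = B c j + y c &
    v = B d j + y d].
Proof.
move=> tr lt_j [le_v [c0 le_c0 at_v]]; have pos := tree_full tr.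
have [[lt inj tg] _ _ par tgp _] := tr.
have at_tight c : (c <= n)%N -> tight B y n j c -> v = B c j + y c.
  by move=> le_c tgc; apply/eqP; rewrite eq_le le_v //= at_v tgc.
(* As an injection of a finite set into itself, [rho] is onto, so some node carries [j]. *)
pose f (c : 'I_n) : 'I_n := Ordinal (lt c (ltn_ord c)).
have f_inj : injective f.
  by move=> c d [/(inj _ _ (ltn_ord c) (ltn_ord d))]; exact: val_inj.
have [g fK gK] := injF_bij f_inj.
set c := g (Ordinal lt_j).
have Ec : rho c = j by have /(congr1 val) := gK (Ordinal lt_j).
have [le_pi _ lt_rk] := par c (ltn_ord c) (pos c (ltn_ord c)).
have le_c := ltnW (ltn_ord c).
exists c, (pi c); split=> //.
- by move=> E; rewrite -E ltnn in lt_rk.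
- by apply: at_tight => //; rewrite -{1}Ec; exact: tg.
- by apply: at_tight => //; rewrite -{1}Ec; apply: tgp => //; exact: pos.
Qed.

Lemma solver_ok s :
  idx s 0 0 1 = n -> num s 1 = B ->
  wp M solver (fun s' => exists y, forall j, (j < n)%N ->
    attained_min y j (num s' 2 0 j) /\
    exists c d, [/\ (c <= n)%N, (d <= n)%N, c <> d,
      num s' 2 0 j = B c j + y c & num s' 2 0 j = B d j + y d]) s.
Proof.
move=> en eB; apply/wp_seq/wp_setI/wp_seq => /=.
(* After [q] rounds the first [q] equations span the unknowns from [0] to [q]; initially the tree is
   the unknown [0] alone. *)
apply: (wp_for (N := n) (I := fun q s' => idx s' 2 0 0 = q /\
  exists rho pi rk y, state q rho pi rk y s' /\ tree B q q rho pi rk y)).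
- exact: ltnW.
- by move=> q s' [eq [? [? [? [? [st _]]]]]] /=; rewrite (st_n st).
- split=> //.
    exists (idx s 9 0), (idx s 10 0), (upd (idx s 11 0) 0 1%N), (num s 3 0).
  by split=> //; split=> //; [move=> [|]|rewrite big_ord0].
- move=> r s1 lt_r [er [rho [pi [rk [y [st1 tr]]]]]].
  apply: wp_seq; apply: wp_mono (argmin_row_ok lt_r st1) => s2 [st2 le_cur tg].
  apply: wp_seq; apply: wp_mono (reroot_ok lt_r st2 tr le_cur tg).
  move=> s3 [rho3 st3 mt]; apply: wp_seq.
  apply: wp_mono (new_root_ok lt_r st3 mt) => s4 [rk4 [y4 [st4 tr4]]].
  apply: wp_mono (grow_ok lt_r st4 tr4) => s5 [pi5 [rk5 [y5 [st5 tr5]]]].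
  split; first exact: st_r st5.
  split=> //; exists rho3, pi5, rk5, y5; split=> //.
  by case: st5 => *; split.
- move=> s1 [_ [rho [pi [rk [y [st1 tr]]]]]].
  apply: wp_mono (output_ok st1) => s2 out; exists y => j lt_j.
  by split; [exact: out|exact: tree_two_minima tr lt_j (out j lt_j)].
Qed.

End Correctness.

(** * Tropical combinations of solutions of the subsystems *)

Section TropicalCombination.
Variables (R : realDomainType) (m n : nat) (A : 'M[int]_(m, n)).
Variables (S : 'I_n.+1 -> {set 'I_m}) (X : 'M[R]_(n.+1, n)).

Lemma mem_minimizers (a : 'rV[int]_n) (x : 'rV[R]_n) (j k : 'I_n) :
  j \in minimizers a x -> (a 0 j)%:~R + x 0 j <= (a 0 k)%:~R + x 0 k.
Proof. by rewrite inE => /forallP. Qed.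

Lemma subsystem_row (T : {set 'I_m}) (x : 'rV[R]_n) (i : 'I_m) :
  tropical_solution (subsystem A T) x -> i \in T ->
  (1 < #|minimizers (row i A) x|)%N.
Proof.
move=> sol iT; have := sol (enum_rank_in iT i).
by rewrite /subsystem row_rowsub enum_rankK_in.
Qed.

(* If the minimum over [k] of [X k j + l k] is always attained twice, it is
   attained on the solutions of the subsystems containing a given row, since at
   most one subsystem misses it; on these [x] is an honest combination. *)
Lemma combination_solution (l : 'I_n.+1 -> R) (x : 'rV[R]_n) :
  (0 < n)%N ->
  (forall i : 'I_m, (n <= #|[set k | i \in S k]|)%N) ->
  (forall k, tropical_solution (subsystem A (S k)) (row k X)) ->
  (forall j k, x 0 j <= X k j + l k) ->
  (forall j, exists k1 k2, [/\ k1 != k2, x 0 j = X k1 j + l k1 &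
     x 0 j = X k2 j + l k2]) ->
  tropical_solution A x.
Proof.
move=> n_gt0 cov sol le_x two i.
have [j0 min0] : exists j0 : 'I_n, forall j,
    (A i j0)%:~R + x 0 j0 <= (A i j)%:~R + x 0 j.
  case: (@arg_minP _ _ _ (Ordinal n_gt0) xpredT
    (fun j => (A i j)%:~R + x 0 j : R)) => // j0 _ min0.
  by exists j0 => j; exact: min0.
have [k ik xk] : exists2 k, i \in S k & x 0 j0 = X k j0 + l k.
  have [k1 [k2 [ne e1 e2]]] := two j0.
  case: (boolP (i \in S k1)) => [|n1]; first by exists k1.
  case: (boolP (i \in S k2)) => [|n2]; first by exists k2.
  (* Two subsystems missing row [i] would leave at most [n - 1] of the [n + 1] containing it. *)
  have : ([set k1; k2] \subset ~: [set k | i \in S k]).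
    by apply/subsetP => k; rewrite !inE => /orP[]/eqP->.
  move=> /subset_leq_card; rewrite cards2 ne.
  have := cardsC [set k | i \in S k]; rewrite card_ord.
  have := cov i; lia.
apply: leq_trans (subsystem_row (sol k) ik) (subset_leq_card _).
(* With [a = A i], the chain is [a j + x j <= a j + X k j + l k <= a j0 + X k j0 + l k = a j0 + x j0
   <= a j' + x j']. *)
apply/subsetP => j jmin; rewrite inE; apply/forallP => j'.
rewrite !mxE; have := mem_minimizers j0 jmin; rewrite !mxE.
have := min0 j'; have := le_x j k; rewrite xk.
by move: (A i j0)%:~R (A i j)%:~R (A i j')%:~R => a0 a a'; lra.
Qed.

End TropicalCombination.

(** * Solving the whole system *)

Lemma solver_correct (R : realDomainType) (m n : nat) (A : 'M[int]_(m, n))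
    (S : 'I_n.+1 -> {set 'I_m}) (X : 'M[R]_(n.+1, n)) :
  (0 < n)%N ->
  (forall i : 'I_m, (n <= #|[set k | i \in S k]|)%N) ->
  (forall k : 'I_n.+1, tropical_solution (subsystem A (S k)) (row k X)) ->
  exists (t : nat) (s : memory R),
    [/\ exec solver (input_memory A S X) t s,
        (t <= (cost_poly solver).[(m + n)%N])%N
      & tropical_solution A (output_row n s)].
Proof.
move=> n_gt0 cov sol.
have le_nM : (n < (m + n).+1)%N by rewrite ltnS leq_addl.
have [t [s [ex le [y out]]]] :=
  solver_ok le_nM (erefl : idx (input_memory A S X) 0 0 1 = n)
    (erefl : num (input_memory A S X) 1 = mxcell X).
exists t, s; split=> //; first by rewrite horner_cost_poly.
have cellE (k : 'I_n.+1) (j : 'I_n) : mxcell X k j = X k j.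
  by rewrite /mxcell !valK.
(* The final values of the unknowns are the weights of the combination. *)
apply: (combination_solution (l := fun k => y k)) sol _ _ => //.
  move=> j k; rewrite mxE -cellE.
  by have [[le_out _] _] := out j (ltn_ord j); apply: le_out; rewrite -ltnS.
move=> j; have [_ [c [d [le_c le_d ne ec ed]]]] := out j (ltn_ord j).
exists (Ordinal (le_c : (c < n.+1)%N)), (Ordinal (le_d : (d < n.+1)%N)).
by rewrite mxE -!cellE; split=> //; apply/eqP => -[].
Qed.

Theorem theorem2 :
  (forall (R : realDomainType) (m n : nat) (A : 'M[int]_(m, n))
      (S : 'I_n.+1 -> {set 'I_m}),
    (0 < n)%N ->
    (forall i : 'I_m, (n <= #|[set k | i \in S k]|)%N) ->
    (forall k : 'I_n.+1, tropical_feasible R (subsystem A (S k))) ->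
    tropical_feasible R A)
  /\
  (exists (c : cmd) (p : {poly nat}),
    forall (R : realDomainType) (m n : nat) (A : 'M[int]_(m, n))
      (S : 'I_n.+1 -> {set 'I_m}) (X : 'M[R]_(n.+1, n)),
    (0 < n)%N ->
    (forall i : 'I_m, (n <= #|[set k | i \in S k]|)%N) ->
    (forall k : 'I_n.+1, tropical_solution (subsystem A (S k)) (row k X)) ->
    exists (t : nat) (s : memory R),
      [/\ exec c (input_memory A S X) t s,
          (t <= p.[(m + n)%N])%N
        & tropical_solution A (output_row n s)]).
Proof.
split; last by exists solver, (cost_poly solver); exact: solver_correct.
move=> R m n A S n_gt0 cov feas.
(* Feasibility follows by running the program on solutions chosen for the subsystems and stacked as
   the rows of a matrix. *)
have [x sol] := fin_all_exists feas.
have [|t [s [_ _ sol_s]]] :=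
  @solver_correct R m n A S (\matrix_(k, j) x k 0 j) n_gt0 cov.
  move=> k; suff -> : row k (\matrix_(k, j) x k 0 j) = x k by [].
  by apply/rowP => j; rewrite !mxE.
by exists (output_row n s).
Qed.
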